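(* Let $L$ and $M$ be metric spaces. Every morphism $L_{u}\to M_{u}$ in $\mathrm{sFilt}$ is of the form $(x_1,\dots,x_n)\mapsto (f(x_1),\dots,f(x_n))$, $L^n\to M^n$ $(n\ge 1)$, for a unique function $f:L\to M$, and a function $f:L\to M$ defines a morphism $L_{u}\to M_{u}$ in $\mathrm{sFilt}$ in this way if and only if $f$ is uniformly continuous.
   Context: A filter on a set $X$ is a collection of subsets of $X$, called neighbourhoods, closed under finite intersections (in particular containing $X$) and under passing to supersets; $\emptyset$ is allowed to be a neighbourhood and $X$ is allowed to be empty. A morphism of filters (a continuous map) is a function of the underlying sets such that the preimage of every neighbourhood is a neighbourhood. $\mathrm{Filt}$ is the category of filters. $\Delta$ is the category of finite linear orders $n_\le=\{0<\dots<n-1\}$, $n\ge 1$, and non-decreasing maps, and $\mathrm{sFilt}=\mathrm{Fun}(\Delta^{op},\mathrm{Filt})$ is the category of simplicial filters; a morphism in $\mathrm{sFilt}$ is a map of the underlying simplicial sets which is continuous at every level. For a metric space $M$, $M_{u}\in\mathrm{sFilt}$ has underlying simplicial set $n_\le\mapsto \mathrm{Hom}_{\mathrm{Sets}}(n,M)=M^n$, and $\varepsilon\subset M^n$ is a neighbourhood iff there is $\epsilon>0$ such that $(x_1,\dots,x_n)\in\varepsilon$ whenever $\mathrm{dist}(x_i,x_j)<\epsilon$ for all $i,j$. *)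

(* Defs.v *)
From HB Require Import structures.
From mathcomp Require Import all_boot all_order all_algebra.
From mathcomp Require Import all_classical all_reals all_analysis.

Set Implicit Arguments.
Unset Strict Implicit.
Unset Printing Implicit Defensive.

Import Order.TTheory GRing.Theory Num.Theory.

Local Open Scope classical_set_scope.
Local Open Scope ring_scope.

(* [Filter] does not exclude [set0], and the carrier may be empty. *)
Record filt := Filt {
  filt_sort :> Type;
  nbhd : set_system filt_sort;
  nbhd_filter : Filter nbhd }.
Arguments nbhd : clear implicits.

Record filt_hom (X Y : filt) := FiltHom {
  filt_fun :> X -> Y;
  filt_cont : forall V : set Y, nbhd Y V -> nbhd X (filt_fun @^-1` V) }.

(* The object [n] stands for the linear order {0 < ... < n}, with n.+1
   elements, so that the nonempty finite linear orders are indexed by [nat]. *)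
Record delta_hom (m n : nat) := DeltaHom {
  delta_fun :> 'I_m.+1 -> 'I_n.+1;
  delta_mono : {homo delta_fun : i j / (i <= j)%N} }.

Definition delta_id (n : nat) : delta_hom n n :=
  @DeltaHom n n id (fun _ _ h => h).

Definition delta_comp (m n p : nat) (b : delta_hom n p) (a : delta_hom m n) :
  delta_hom m p :=
  @DeltaHom m p (b \o a) (fun _ _ h => delta_mono b (delta_mono a h)).

Record sFilt := SFilt {
  sf_ob :> nat -> filt;
  sf_map : forall m n, delta_hom m n -> filt_hom (sf_ob n) (sf_ob m);
  sf_map_id : forall n, sf_map (delta_id n) =1 id;
  sf_map_comp : forall m n p (b : delta_hom n p) (a : delta_hom m n),
    sf_map (delta_comp b a) =1 sf_map a \o sf_map b }.

Record sFilt_hom (X Y : sFilt) := SFiltHom {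
  sf_fun :> forall n, filt_hom (X n) (Y n);
  sf_natural : forall m n (a : delta_hom m n),
    sf_fun m \o sf_map X a =1 sf_map Y a \o sf_fun n }.

Section MetricSFilt.
Variables (R : realType) (M : metricType R).

Definition metric_nbhd (n : nat) : set_system ('I_n.+1 -> M) :=
  [set E | exists2 e : R, 0 < e &
    forall x : 'I_n.+1 -> M, (forall i j, mdist (x i) (x j) < e) -> E x].

Lemma metric_nbhd_filter (n : nat) : Filter (@metric_nbhd n).
Proof.
split.
- by exists 1.
- move=> A B [a a0 hA] [b b0 hB]; exists (Order.min a b).
    by rewrite lt_min a0 b0.
  move=> x hx; split; [apply: hA | apply: hB] => i j;
    by have := hx i j; rewrite lt_min => /andP[].
- by move=> A B sAB [a a0 hA]; exists a => // x /hA /sAB.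
Qed.

Definition metric_ob (n : nat) : filt :=
  Filt (@metric_nbhd_filter n).

Lemma metric_map_cont (m n : nat) (a : delta_hom m n) (V : set (metric_ob m)) :
  nbhd (metric_ob m) V ->
  nbhd (metric_ob n) ((fun x : 'I_n.+1 -> M => x \o a) @^-1` V).
Proof. by move=> [e e0 hV]; exists e => // x hx; apply: hV => i j; apply: hx. Qed.

Definition metric_map (m n : nat) (a : delta_hom m n) :
  filt_hom (metric_ob n) (metric_ob m) :=
  @FiltHom (metric_ob n) (metric_ob m) (fun x => x \o a) (@metric_map_cont m n a).

(* The simplicial filter M_u. *)
Definition metric_sFilt : sFilt :=
  @SFilt metric_ob metric_map (fun _ _ => erefl) (fun _ _ _ _ _ _ => erefl).

End MetricSFilt.

(* [phi] is (x_1, ..., x_n) |-> (f x_1, ..., f x_n) in every degree n >= 1. *)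
Definition is_levelwise (R : realType) (L M : metricType R)
    (phi : sFilt_hom (metric_sFilt L) (metric_sFilt M)) (f : L -> M) : Prop :=
  forall (n : nat) (x : 'I_n.+1 -> L), phi n x = f \o x.

(* Main.v *)
Require Import Defs.
From mathcomp Require Import all_boot all_order all_algebra.
From mathcomp Require Import all_classical all_reals all_analysis.

(** A tuple in [L^n] is determined by its restrictions along the [n] vertex maps
    [1 -> n] of [Delta], so naturality forces a morphism to act on each
    coordinate by its degree-one component.  Continuity in degree two is then
    uniform continuity of that component, which conversely gives continuity in
    every degree, since neighbourhoods only constrain pairs of coordinates. *)

Import Order.TTheory GRing.Theory Num.Theory.

Local Open Scope classical_set_scope.
Local Open Scope ring_scope.

Definition delta_vertex (n : nat) (i : 'I_n.+1) : delta_hom 0 n :=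
  @DeltaHom 0 n (fun=> i) (fun _ _ _ => leqnn i).

(** Passes from the uniform structure to the epsilon-delta form, which is how [metric_nbhd] measures
    neighbourhoods. *)
Lemma unif_continuous_mdistP (R : realType) (L M : metricType R) (f : L -> M) :
  unif_continuous f <->
  forall e : R, 0 < e -> exists2 d : R, 0 < d &
    forall x y : L, mdist x y < d -> mdist (f x) (f y) < e.
Proof.
rewrite unif_continuousP; split=> h e e0; have [d d0 hd] := h e e0;
  exists d => //.
- by move=> x y xy; have := hd (x, y); rewrite /= !ballEmdist; apply.
- by case=> x y /=; rewrite !ballEmdist; apply: hd.
Qed.

Section MetricMorphisms.
Variables (R : realType) (L M : metricType R).
Implicit Types (phi : sFilt_hom (metric_sFilt L) (metric_sFilt M)) (f : L -> M).

Definition degree_one phi (x : L) : M := phi 0 (fun=> x) ord0.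

Lemma degree_one_levelwise phi : is_levelwise phi (degree_one phi).
Proof.
move=> n x; apply/funext => i.
(* Restricting [x] along the vertex [i] gives, by conversion, the constant 1-tuple [x i]. *)
have := sf_natural phi (delta_vertex n i) x.
by move=> /(congr1 (fun y => y ord0)).
Qed.

Lemma levelwise_inj phi f : is_levelwise phi f -> degree_one phi = f.
Proof. by move=> phif; apply/funext => x; rewrite /degree_one phif. Qed.

Lemma levelwise_unif_continuous phi f : is_levelwise phi f -> unif_continuous f.
Proof.
move=> phif; apply/unif_continuous_mdistP => e e0.
(* Index 1 is the two-element order, so this pulls back a basic neighbourhood of [M^2]. *)
have [|d d0 hd] := @filt_cont _ _ (phi 1)
    [set z : 'I_2 -> M | forall i j, mdist (z i) (z j) < e].
  by exists e.
exists d => // x y xy.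
(* The pair [(x, y)] as a function on ['I_2]: the diagonal distances vanish, and symmetry reduces
   the other two to [xy]. *)
have /hd /= : forall i j : 'I_2,
    mdist (if i == ord0 then x else y) (if j == ord0 then x else y) < d.
  by move=> i j; do 2![case: ifP => _]; rewrite ?mdistxx // metric_sym.
by rewrite phif => /(_ ord0 ord_max).
Qed.

Section UniformlyContinuous.
Variable f : L -> M.
Hypothesis f_unif : unif_continuous f.

Lemma postcomp_cont (n : nat) (V : set (metric_ob M n)) :
  nbhd (metric_ob M n) V ->
  nbhd (metric_ob L n) ((fun x : 'I_n.+1 -> L => f \o x) @^-1` V).
Proof.
move=> [e e0 hV].
have [d d0 hd] := (unif_continuous_mdistP _ _ _ _).1 f_unif e e0.
by exists d => // x hx; apply: hV => i j; apply: hd.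
Qed.

Definition postcomp (n : nat) : filt_hom (metric_sFilt L n) (metric_sFilt M n) :=
  @FiltHom (metric_ob L n) (metric_ob M n) (fun x => f \o x) (postcomp_cont n).

(** Naturality holds by conversion: composing with [f] on the left commutes with reindexing on the
    right. *)
Definition metric_sFilt_hom : sFilt_hom (metric_sFilt L) (metric_sFilt M) :=
  @SFiltHom (metric_sFilt L) (metric_sFilt M) postcomp
    (fun _ _ _ _ => erefl).

End UniformlyContinuous.

End MetricMorphisms.

Theorem mainTheorem1 (R : realType) (L M : metricType R) :
  (forall phi : sFilt_hom (metric_sFilt L) (metric_sFilt M),
     exists! f : L -> M, is_levelwise phi f) /\
  (forall f : L -> M,
     (exists phi : sFilt_hom (metric_sFilt L) (metric_sFilt M),
        is_levelwise phi f) <-> unif_continuous f).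
Proof.
split=> [phi|f].
  exists (degree_one _ _ _ phi); split; first exact: degree_one_levelwise.
  by move=> f; apply: levelwise_inj.
split=> [[phi]|f_unif]; first exact: levelwise_unif_continuous.
by exists (metric_sFilt_hom _ _ _ f f_unif).
Qed.
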